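(* Let $k\ge 2$ and let $n_1\ge n_2\ge \dots\ge n_k$ be positive integers. Let $K_{n_1,n_2,\dots,n_k}$ be the complete $k$-partite graph with $n_i$ vertices in the $i$-th part, and let $N=\sum_{i=1}^k n_i$. Then $$S(K_{n_1,n_2,\dots,n_k})=2N-n_1-n_2-1.$$
   Context: For a finite simple graph $G=(V,E)$ and an injective map $f:V\to\mathbb Z$, let $\sigma(G,f)=\{f(v)+f(w): vw\in E\}$. The sum index of $G$ is $S(G)=\min_{f}|\sigma(G,f)|$, the minimum over all injective maps $f:V\to\mathbb Z$. *)

(* Defs.v *)
From mathcomp Require Import all_boot all_order all_algebra.
From mathcomp Require Import finmap.
From mathcomp Require Import boolp.
Set Implicit Arguments.
Unset Strict Implicit.
Unset Printing Implicit Defensive.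

Record sgraph := SGraph {
  svertex :> finType;
  sedge : rel svertex;
  sedge_sym : symmetric sedge;
  sedge_irrefl : irreflexive sedge }.

Definition edge_sums (G : sgraph) (f : G -> int) : {fset int} :=
  [fset (f e.1 + f e.2)%R | e in [pred e : G * G | sedge e.1 e.2]]%fset.

Definition sum_count (G : sgraph) (m : nat) : Prop :=
  exists f : G -> int, injective f /\ #|` edge_sums f|%fset = m.

Lemma sum_count_ex (G : sgraph) : exists m, `[< sum_count G m >].
Proof.
pose f (x : G) : int := Posz (enum_rank x).
exists #|` edge_sums f|%fset; apply/asboolP; exists f; split=> //.
by move=> x y [] /val_inj /enum_rank_inj.
Qed.

Definition sum_index (G : sgraph) : nat := ex_minn (sum_count_ex G).

Section CompleteMultipartite.
Variables (k : nat) (n : 'I_k -> nat).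

Definition multipartite_vertex : finType := {i : 'I_k & 'I_(n i)}.

Definition multipartite_edge : rel multipartite_vertex :=
  fun u v => tag u != tag v.

Lemma multipartite_edge_sym : symmetric multipartite_edge.
Proof. by move=> u v; rewrite /multipartite_edge eq_sym. Qed.

Lemma multipartite_edge_irrefl : irreflexive multipartite_edge.
Proof. by move=> u; rewrite /multipartite_edge eqxx. Qed.

Definition complete_multipartite : sgraph :=
  SGraph multipartite_edge_sym multipartite_edge_irrefl.

End CompleteMultipartite.

(* Main.v *)
(** Lower bound: let a and b be the vertices with the smallest and largest label,
    A and B their parts.  The sums f a + f y (y not in A) and f b + f x (x not in
    B) coincide only at f a + f b, which gives 2N - |A| - |B| - 1 sums if A <> B
    and 2N - 2|A| sums if A = B.  The latter suffices unless A is much larger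
    than every other part; in that case delete a and induct, since the smallest
    sum of the graph uses a and hence is lost.

    Upper bound: give the labels 0, ..., N - 1 in increasing order to the first
    part, then to all parts but the first two, then to the second part.  Every
    sum then lies in [n_1, 2N - n_2 - 2]. *)
Require Import Defs.
From mathcomp Require Import all_boot all_order all_algebra.
From mathcomp Require Import finmap.
From mathcomp Require Import boolp.
From mathcomp Require Import zify.

Set Implicit Arguments.
Unset Strict Implicit.
Unset Printing Implicit Defensive.

Lemma card_tag_eq (I : finType) (T_ : I -> finType) (i : I) :
  #|[set v : {j : I & T_ j} | tag v == i]| = #|T_ i|.
Proof.
rewrite -[#|T_ i|]cardsT.
have -> : [set v : {j : I & T_ j} | tag v == i]
    = [set Tagged T_ x | x in [set: T_ i]].
  apply/setP=> -[j x]; rewrite inE /=; apply/eqP/imsetP => [ji|[y _ /(congr1 tag)]//].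
  by subst j; exists x.
by rewrite card_imset // => x y /eqP; rewrite eq_Tagged => /eqP.
Qed.

(** * Lower bound, for an arbitrary colouring *)

Section CrossSums.
Variables (T : finType) (I : eqType) (col : T -> I) (f : T -> int).
Hypothesis f_inj : injective f.

(** The edge sums of the complete multipartite graph induced on [S], with the fibres of [col] as
    parts. Working relative to [S] lets the induction delete vertices within a fixed type. *)
Definition cross_sums (S : {set T}) : {fset int} :=
  [fset (f e.1 + f e.2)%R | e in
     [pred e : T * T | [&& e.1 \in S, e.2 \in S & col e.1 != col e.2]]]%fset.

Definition part (S : {set T}) (i : I) : {set T} := [set x in S | col x == i].

Lemma cross_sumsP (S : {set T}) (z : int) :
  reflect (exists x y, [/\ x \in S, y \in S, col x != col y & z = (f x + f y)%R])
          (z \in cross_sums S).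
Proof.
apply: (iffP (imfsetP _ _ _ _)) => [[[x y] /and3P[xS yS xy] ->]|[x [y [xS yS xy ->]]]].
  by exists x, y.
by exists (x, y) => //; apply/and3P.
Qed.

Lemma mem_cross_sums (S : {set T}) (x y : T) :
  x \in S -> y \in S -> col x != col y -> (f x + f y)%R \in cross_sums S.
Proof. by move=> *; apply/cross_sumsP; exists x, y. Qed.

Lemma card_part_compl (S : {set T}) (i : I) :
  #|[set x in S | col x != i]| + #|part S i| = #|S|.
Proof.
rewrite addnC -(cardsID [set x | col x == i] S); congr (_ + _); apply: eq_card => x.
  by rewrite !inE.
by rewrite !inE andbC.
Qed.

(** If [f a + f y = f b + f x], then [f y <= f b] and [f a <= f x] force [x = a]. Hence discarding
    [a] from [X] makes all listed sums distinct; this costs one sum exactly when [a] and [b] have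
    different colours, which the last summand records. *)
Lemma extremal_cross_sums (S : {set T}) (a b : T) :
  a \in S -> b \in S ->
  (forall x, x \in S -> (f a <= f x)%R) -> (forall x, x \in S -> (f x <= f b)%R) ->
  2 * #|S| <= #|` cross_sums S|%fset + #|part S (col a)| + #|part S (col b)|
              + (col a != col b).
Proof.
move=> aS bS amin bmax.
pose Y := [set x in S | col x != col a]; pose X := [set x in S | col x != col b].
pose s := [seq (f a + f y)%R | y <- enum Y] ++ [seq (f b + f x)%R | x <- enum (X :\ a)].
have s_uniq : uniq s.
  rewrite cat_uniq !map_inj_in_uniq ?enum_uniq ?andbT /=; last 2 first.
  - by move=> x y _ _ e; apply: f_inj; lia.
  - by move=> x y _ _ e; apply: f_inj; lia.
  apply/hasPn => z /mapP[x]; rewrite mem_enum !inE => /and3P[xa xS _] ->.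
  apply/mapP => -[y]; rewrite mem_enum !inE => /andP[yS _] e.
  have := amin _ xS; have := bmax _ yS => yb ax.
  by move/eqP: xa; apply; apply: f_inj; lia.
have s_sub : {subset s <= cross_sums S}.
  move=> z; rewrite mem_cat => /orP[] /mapP[x]; rewrite mem_enum !inE.
    by move=> /andP[xS xa] ->; apply: mem_cross_sums; rewrite // eq_sym.
  by move=> /and3P[_ xS xb] ->; apply: mem_cross_sums; rewrite // eq_sym.
have := uniq_leq_size s_uniq s_sub.
rewrite size_cat !size_map -!cardE.
have hY : #|Y| + #|part S (col a)| = #|S| := card_part_compl S (col a).
have hX : #|X| + #|part S (col b)| = #|S| := card_part_compl S (col b).
have hXa : #|X| = (col a != col b) + #|X :\ a|.
  by rewrite (cardsD1 a X) {1}/X inE aS.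
move=> hs; have {}hs : #|Y| + #|X :\ a| <= #|` cross_sums S|%fset := hs.
lia.
Qed.

Lemma card_cross_sums_del_min (S : {set T}) (a c : T) :
  a \in S -> c \in S -> col c != col a ->
  (forall x, x \in S -> (f a <= f x)%R) ->
  #|` cross_sums (S :\ a)|%fset < #|` cross_sums S|%fset.
Proof.
move=> aS cS ca amin.
pose P := [pred x | (x \in S) && (col x != col a)].
have cP : P c by rewrite /= cS.
(* The given [c] is replaced by a vertex of least label outside the part of [a]; the sum that
   disappears is [f a + f c]. *)
case: (Order.TotalTheory.arg_minP f cP) => {cP ca cS}c /andP[cS ca] cmin.
apply: fproper_ltn_card; rewrite fproperE; apply/andP; split.
  apply/fsubsetP => z /cross_sumsP[x [y []]]; rewrite !inE => /andP[_ xS] /andP[_ yS] xy ->.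
  exact: mem_cross_sums.
have acS : (f a + f c)%R \in cross_sums S by apply: mem_cross_sums; rewrite // eq_sym.
apply/fsubsetP => /(_ _ acS)/cross_sumsP[x [y []]]; rewrite !inE => /andP[xa xS] /andP[ya yS] xy e.
have flt z : z != a -> z \in S -> (f a < f z)%R.
  move=> za zS; rewrite Order.POrderTheory.lt_neqAle amin // andbT.
  by apply: contraNneq za => /f_inj ->.
have := flt _ xa xS; have := flt _ ya yS => ay ax.
(* One endpoint lies outside the part of [a], so its label is at least [f c]; the other label
   exceeds [f a]. The sum is thus strictly larger than [f a + f c]. *)
have [xA|xA] := eqVneq (col x) (col a).
  have := cmin y; rewrite /= yS -xA eq_sym xy => /(_ isT); lia.
have := cmin x; rewrite /= xS xA => /(_ isT); lia.
Qed.

(** Taking any bound [m] on the size of two parts together makes the induction on [#|S|] run: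
    deleting [a] lowers [#|S|] and [m] by one and loses at least one sum. The pair [u], [v] ensures
    that an edge exists. *)
Lemma leq_card_cross_sums (S : {set T}) (m : nat) (u v : T) :
  u \in S -> v \in S -> col u != col v ->
  (forall i j, i != j -> #|part S i| + #|part S j| <= m) ->
  2 * #|S| <= #|` cross_sums S|%fset + m + 1.
Proof.
have [p] := ubnP #|S|; elim: p => // p IH in S m u v *.
move=> Sp uS vS uv hm.
have [a aS amin] : exists2 a, a \in S & forall x, x \in S -> (f a <= f x)%R.
  by case: (Order.TotalTheory.arg_minP f uS) => a; exists a.
have [b bS bmax] : exists2 b, b \in S & forall x, x \in S -> (f x <= f b)%R.
  by case: (Order.TotalTheory.arg_maxP f uS) => b; exists b.
have := extremal_cross_sums aS bS amin bmax.
have [ab|ab] := eqVneq (col a) (col b); last by have := hm _ _ ab; lia.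
rewrite -ab => hext.
have [|Abig] := leqP (2 * #|part S (col a)|) (m + 1); first by lia.
have [c cS ca] : exists2 c, c \in S & col c != col a.
  have [ua|ua] := eqVneq (col u) (col a); last by exists u.
  (* Since [u] or [v] may be the deleted vertex, [b] and [c] serve as the differently coloured pair
     in [S :\ a]. *)
  by exists v; rewrite // -ua eq_sym.
have lt_sums := card_cross_sums_del_min aS cS ca amin.
have ac : a != c by apply: contraNneq ca => ->.
have nab : b != a.
  apply: contraNneq ac => ba; apply/eqP/f_inj.
  by have := amin _ cS; have := bmax _ cS; rewrite ba; lia.
have cardS := cardsD1 a S; rewrite aS in cardS.
have partS i : #|part S i| = (col a == i) + #|part (S :\ a) i|.
  rewrite (cardsD1 a (part S i)) inE aS /=; congr (_ + _); apply: eq_card => x.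
  by rewrite !inE andbA.
have m_gt0 : 0 < m.
  by have := hm _ _ ca; have := partS (col a); rewrite eqxx; lia.
(* A pair involving the part of [a] loses one vertex. Any other part has at most
   [m - #|part S (col a)|] vertices, so by [Abig] two of them have at most [m - 2] together. *)
suff hm' : forall i j, i != j -> #|part (S :\ a) i| + #|part (S :\ a) j| <= m.-1.
  have := IH (S :\ a) m.-1 b c; rewrite !inE nab bS cS (eq_sym c) ac -ab (eq_sym (col a)) ca.
  have Sap : #|S :\ a| < p by lia.
  by move/(_ Sap isT isT isT hm'); lia.
move=> i j ij; have hij := hm _ _ ij.
have hi := partS i; have hj := partS j.
have [ai|ai] := eqVneq (col a) i; first by rewrite ai eqxx in hi *; lia.
have [aj|aj] := eqVneq (col a) j; first by rewrite aj eqxx in hj *; lia.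
have := hm _ _ ai; have := hm _ _ aj; lia.
Qed.

End CrossSums.

(** * The labelling for the upper bound *)

Section BlockLabel.
Variables (T : finType) (A B : {pred T}).
Hypothesis disjAB : forall x, x \in A -> x \notin B.

Definition block_seq : seq T :=
  enum A ++ enum [predC [predU A & B]] ++ enum B.

Definition block_label (x : T) : nat := index x block_seq.

Lemma mem_block_seq (x : T) : x \in block_seq.
Proof.
rewrite !mem_cat !mem_enum !inE.
by case: (x \in A); case: (x \in B).
Qed.

Lemma size_block_seq : size block_seq = #|T|.
Proof.
have U : uniq block_seq.
  rewrite !cat_uniq !enum_uniq !has_cat !negb_or /= andbT.
  apply/andP; split; last first.
    by apply/hasPn => x; rewrite !mem_enum !inE negb_or => ->; rewrite andbF.
  apply/andP; split; apply/hasPn => x; rewrite !mem_enum ?inE; first by case/norP.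
  by move=> xB; apply/negP => /disjAB; rewrite xB.
by rewrite cardT; apply/perm_size/uniq_perm; rewrite ?enum_uniq // => x;
   rewrite mem_block_seq mem_enum.
Qed.

Lemma block_label_inj : injective block_label.
Proof.
by move=> x y e; rewrite -(nth_index x (mem_block_seq x)) -/(block_label x) e nth_index ?mem_block_seq.
Qed.

Lemma block_label_lt (x : T) : block_label x < #|T|.
Proof. by rewrite -size_block_seq index_mem mem_block_seq. Qed.

Lemma block_label_geq (x : T) : x \notin A -> #|A| <= block_label x.
Proof.
by move=> xA; rewrite /block_label index_cat mem_enum (negPf xA) -cardE leq_addr.
Qed.

Lemma block_label_ltB (x : T) : x \notin B -> block_label x + #|B| < #|T|.
Proof.
move=> xB; rewrite -size_block_seq /block_label /block_seq catA size_cat -cardE.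
rewrite ltn_add2r index_cat mem_cat !mem_enum !inE (negPf xB) orbF orbN.
by rewrite index_mem mem_cat !mem_enum !inE (negPf xB) orbF orbN.
Qed.

End BlockLabel.

Theorem theorem2p1 (k : nat) (n : 'I_k -> nat) (hk : 2 <= k)
    (n_pos : forall i : 'I_k, 0 < n i)
    (n_noninc : forall i j : 'I_k, i <= j -> n j <= n i) :
  sum_index (complete_multipartite n) =
    2 * (\sum_(i < k) n i) - n (Ordinal (ltnW hk)) - n (Ordinal hk) - 1.
Proof.
set i0 := Ordinal (ltnW hk); set i1 := Ordinal hk.
pose V : finType := complete_multipartite n.
have cardV : #|V| = \sum_(i < k) n i.
  rewrite card_tagged sumnE big_map big_enum /=.
  by apply: eq_bigr => i _; rewrite card_ord.
have cardP i : #|[set v : V | tag v == i]| = n i by rewrite card_tag_eq card_ord.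
have i01 : i0 != i1 by [].
have lower (f : V -> int) : injective f ->
    2 * (\sum_(i < k) n i) - n i0 - n i1 - 1 <= #|` @edge_sums (complete_multipartite n) f|%fset.
  move=> f_inj.
  have -> : @edge_sums (complete_multipartite n) f = cross_sums (@tag _ _) f [set: V].
    apply/fsetP => z; apply/imfsetP/cross_sumsP => [[[x y] xy ->]|[x [y [_ _ xy ->]]]].
      by exists x, y; split; rewrite ?in_setT.
    by exists (x, y).
  have partT i : #|part (@tag _ _) [set: V] i| = n i.
    by rewrite -cardP; apply: eq_card => v; rewrite !inE.
  have h0 l : n l <= n i0 by apply: n_noninc.
  have h1 (l : 'I_k) : 0 < l -> n l <= n i1 by move=> ?; apply: n_noninc.
  have hm i j : i != j ->
      #|part (@tag _ _) [set: V] i| + #|part (@tag _ _) [set: V] j| <= n i0 + n i1.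
    move=> ij; rewrite !partT.
    (* Of two distinct indices one is positive, so its part has size at most [n i1]. *)
    have [l0|l0] := posnP i; last by rewrite addnC leq_add ?h0 ?h1.
    rewrite leq_add ?h0 ?h1 // lt0n; apply: contraNneq ij => j0.
    by apply/eqP/val_inj; rewrite /= l0 j0.
  have : 2 * #|[set: V]| <= #|` cross_sums (@tag _ _) f [set: V]|%fset + (n i0 + n i1) + 1
    := leq_card_cross_sums f_inj (in_setT (Tagged _ (Ordinal (n_pos i0))))
    (in_setT (Tagged _ (Ordinal (n_pos i1)))) i01 hm.
  by rewrite cardsT cardV; lia.
rewrite /sum_index; case: ex_minnP => m /asboolP[f [f_inj <-]] fmin.
apply/eqP; rewrite eqn_leq lower // andbT.
pose A := [pred v : V | tag v == i0]; pose B := [pred v : V | tag v == i1].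
have disjAB x : x \in A -> x \notin B by rewrite !inE => /eqP ->.
have cA : #|A| = n i0 by rewrite -cardP cardsE.
have cB : #|B| = n i1 by rewrite -cardP cardsE.
pose g (x : V) : int := Posz (block_label A B x).
have g_inj : injective g by move=> x y [] /block_label_inj.
apply: leq_trans (fmin #|` @edge_sums (complete_multipartite n) g|%fset _) _.
  by apply/asboolP; exists g.
set N := \sum_(i < k) n i in cardV *.
(* The integers from [n i0] to [2 * N - n i1 - 2]. *)
pose s := [seq Posz j | j <- iota (n i0) (2 * N - n i0 - n i1 - 1)].
suff sub : {subset (@edge_sums (complete_multipartite n) g) <= s}.
  by have := uniq_leq_size (fset_uniq _) sub; rewrite size_map size_iota.
move=> z /imfsetP[[x y] /= xy ->].
have {}xy : tag x != tag y := xy.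
apply/mapP; exists (block_label A B x + block_label A B y); last by rewrite /g; lia.
have lx := block_label_lt disjAB x; have ly := block_label_lt disjAB y.
(* Some endpoint is outside [A], hence comes after the whole first block. *)
have lo : n i0 <= block_label A B x + block_label A B y.
  have [x0|x0] := eqVneq (tag x) i0.
    by rewrite -cA (leq_trans (block_label_geq B (_ : y \notin A))) ?leq_addl // inE -x0 eq_sym.
  by rewrite -cA (leq_trans (block_label_geq B (_ : x \notin A))) ?leq_addr // inE.
(* Some endpoint is outside [B], so its label is at most [N - n i1 - 1]; the other label is at most
   [N - 1]. *)
have hi : block_label A B x + block_label A B y + n i1 + 1 < 2 * N.
  have [x1|x1] := eqVneq (tag x) i1.
    have /(block_label_ltB disjAB) : y \notin B by rewrite inE -x1 eq_sym.
    by rewrite cB -cardV; move: lx; lia.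
  have /(block_label_ltB disjAB) : x \notin B by rewrite inE.
  by rewrite cB -cardV; move: ly; lia.
by rewrite mem_iota; lia.
Qed.
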